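(* Let $\overline V$ be a Minkowski space whose Finsler metric $F^2$ is positively defined, i.e. $F^2(\overline v)>0$ for all $\overline v\ne0$. Then there exists an orthonormal basis of $\overline V$.
   Context: A Minkowski space is a finite-dimensional real vector space $\overline V$ with a Finsler structure $F$ such that: (1) the Finsler metric $F^2:\overline V\to\mathbb R$ is real valued, in general not necessarily positive definite, and sufficiently differentiable at nonzero vectors; (2) $F(a\overline x)=aF(\overline x)$ for $a>0$; (3) relative to a basis, the coordinates of the metric tensor $g_{ij}(\overline v)=\frac12\frac{\partial^2F^2(\overline v)}{\partial v^i\partial v^j}$, $\overline v\ne 0$, form a nonsingular symmetric matrix. Summation over repeated coordinate indices $i,j$ is understood. An ordered set $\overline e_1,\dots,\overline e_p$ is orthogonal if $g_{ij}(\overline e_k)e_k^ie_k^j\neq0$ for all $k$ and $g_{ij}(\overline e_k)e_k^ie_l^j=0$ for all $k<l$. A basis is orthonormal if it is orthogonal and its vectors have unit length, i.e. $|F(\overline e_k)|=1$. *)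

(* Defs.v *)
From mathcomp Require Export all_boot all_order all_algebra.
From mathcomp Require Export all_classical all_reals all_analysis.
From mathcomp Require Export complex.

Set Implicit Arguments.
Unset Strict Implicit.
Unset Printing Implicit Defensive.

Export Order.TTheory GRing.Theory Num.Theory.
Export numFieldNormedType.Exports.

Local Open Scope classical_set_scope.
Local Open Scope complex_scope.
Local Open Scope ring_scope.

Definition partial (R : realType) (n : nat) (i : 'I_n) (f : 'rV[R]_n -> R)
  : 'rV[R]_n -> R :=
  fun x => 'D_(delta_mx 0 i) f x.

(* Meant for an open set A; partial derivatives of differentiable functions
   use only values near the point, so values of f outside A are irrelevant. *)
Fixpoint class_C (R : realType) (n : nat) (k : nat) (A : set 'rV[R]_n)
    (f : 'rV[R]_n -> R) : Prop :=
  match k with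
  | 0%N => forall x, A x -> {for x, continuous f}
  | k'.+1 => (forall x, A x -> differentiable f x) /\
             (forall i : 'I_n, class_C k' A (partial i f))
  end.

Section Minkowski.
Variables (R : realType) (V : vectType R).

(* Only F^2 is required to be real valued, so F itself takes complex values
   (F v is imaginary where F^2 is negative).  This is F^2 as a real function. *)
Definition finsler_metric (F : V -> R[i]) (v : V) : R := complex.Re (F v ^+ 2).

Variables (n : nat) (b : n.-tuple V) (F : V -> R[i]).

Definition of_coords (x : 'rV[R]_n) : V := \sum_(i < n) x 0 i *: tnth b i.

Definition coords (v : V) : 'rV[R]_n := \row_(i < n) coord b i v.

Definition metric_in_coords (x : 'rV[R]_n) : R := finsler_metric F (of_coords x).

Definition metric_tensor (v : V) : 'M[R]_n :=
  \matrix_(i, j)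
    (2^-1 * partial i (partial j metric_in_coords) (coords v)).

(* "Sufficiently differentiable" is read as twice continuously differentiable,
   the least regularity for which the metric tensor is continuous. *)
Record is_minkowski : Prop := IsMinkowski {
  minkowski_real : forall v : V, F v ^+ 2 \is Num.real;
  minkowski_smooth : class_C 2%N [set x | x != 0] metric_in_coords;
  minkowski_homogeneous :
    forall (a : R) (v : V), 0 < a -> F (a *: v) = a%:C * F v;
  minkowski_symmetric :
    forall v : V, v != 0 -> (metric_tensor v)^T = metric_tensor v;
  minkowski_nonsingular :
    forall v : V, v != 0 -> metric_tensor v \in unitmx
}.

(* The value g_ij(w) u^i v^j. *)
Definition metric_form (w u v : V) : R :=
  \sum_(i < n) \sum_(j < n) metric_tensor w i j * coord b i u * coord b j v.

Definition finsler_orthogonal (p : nat) (e : p.-tuple V) : Prop :=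
  (forall k : 'I_p,
     metric_form (tnth e k) (tnth e k) (tnth e k) != 0) /\
  (forall k l : 'I_p, (k < l)%N ->
     metric_form (tnth e k) (tnth e k) (tnth e l) = 0).

(* The modulus is that of R[i]. *)
Definition finsler_orthonormal_basis (p : nat) (e : p.-tuple V) : Prop :=
  [/\ basis_of fullv e,
      finsler_orthogonal e
    & forall k : 'I_p, `|F (tnth e k)| = 1].

End Minkowski.

(* Main.v *)
(* By Euler's theorem g(v)(v, v) = F^2(v) > 0, so the linear form g(v)(v, _)
   does not vanish at v.  Orthogonality only constrains later vectors by earlier
   ones, so the basis is built greedily: each vector is a unit vector in the
   common kernel of the forms of the previous ones, a subspace losing at most
   one dimension per step.  Linear independence is automatic, since the form of
   the first vector kills all the others but not that vector. *)
From mathcomp Require Import ring.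
Require Import Defs.

Local Open Scope ring_scope.

(** [L] is an arbitrary map into linear forms: [g(v)(v, _)] is linear in its second argument but not
    in [v]. *)
Lemma pairwise_orthogonal_free (K : fieldType) (V : vectType K)
    (L : V -> 'Hom(V, K^o)) (s : seq V) :
  {in s, forall v, L v v != 0} -> pairwise (fun u v => L u v == 0) s -> free s.
Proof.
elim: s => [|v s IHs] Ls; first by rewrite nil_free.
rewrite pairwise_cons free_cons => /andP[/allP v_s s_s]; apply/andP; split.
  apply/negP => vs; have := Ls v (mem_head v s).
  suff /subvP/(_ _ vs) : (span s <= lker (L v))%VS by rewrite memv_ker => ->.
  by apply/span_subvP => u us; rewrite memv_ker v_s.
by apply: IHs => // u us; apply: Ls; rewrite in_cons us orbT.
Qed.

(** The subspace [U] varies in the induction on [m]: once [v] is chosen, the remaining vectors are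
    sought in [U :&: lker (L v)]. The predicate [S] stands for unit length. *)
Lemma exists_pairwise_orthogonal (K : fieldType) (V : vectType K)
    (L : V -> 'Hom(V, K^o)) (S : V -> Prop) (m : nat) (U : {vspace V}) :
  (forall W : {vspace V}, W != 0%VS -> exists2 v, v \in W & S v) ->
  (m <= \dim U)%N ->
  exists s : m.-tuple V,
    [/\ {in s, forall v, v \in U}, {in s, forall v, S v}
      & pairwise (fun u v => L u v == 0) s].
Proof.
move=> exS; elim: m U => [|m IHm] U mU; first by exists [tuple].
have [|v vU Sv] := exS U; first by rewrite -dimv_eq0 -lt0n (leq_trans _ mU).
(* Rank-nullity on [U]: the image of [L v] lies in [K^o], of dimension 1. *)
have dimU : (m <= \dim (U :&: lker (L v)))%N.
  rewrite -ltnS (leq_trans mU)// -(limg_ker_dim (L v) U) -addn1 leq_add2l.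
  by rewrite (leq_trans (dimvS (subvf _)))// dimvf.
have [s [sU sS s_s]] := IHm _ dimU.
exists [tuple of v :: s]; split => [u|u|].
- by rewrite inE => /predU1P[->//|/sU]; rewrite memv_cap => /andP[].
- by rewrite inE => /predU1P[->//|/sS].
- rewrite pairwise_cons s_s andbT; apply/allP => u /sU.
  by rewrite memv_cap memv_ker => /andP[].
Qed.

Section Euler.
Variables (R : realType) (n : nat) (f : 'rV[R]_n -> R).

Lemma diff_partial (x v : 'rV[R]_n) : differentiable f x ->
  'd f x v = \sum_(i < n) v 0 i * partial i f x.
Proof.
move=> df; rewrite {1}[v]row_sum_delta linear_sum; apply: eq_bigr => i _.
by rewrite linearZ /partial deriveE.
Qed.

(** Differentiate [t |-> f (t *: x)] at [t = 1] in two ways: by the chain rule, and as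
    [t ^+ k * f x]. *)
Lemma euler (k : nat) (x : 'rV[R]_n) : differentiable f x ->
  (forall t : R, 0 < t -> f (t *: x) = t ^+ k * f x) ->
  \sum_(i < n) x 0 i * partial i f x = k%:R * f x.
Proof.
move=> df fh; rewrite -diff_partial//.
have dfx : differentiable f (1 *: x) by rewrite scale1r.
have sx : differentiable (fun t : R => t *: x) (1 : R) by exact: ex_diff.
have -> : 'd f x x = 'D_1 (f \o fun t : R => t *: x) 1.
  rewrite deriveE; last exact: differentiable_comp.
  by rewrite (diff_comp sx)// diff_val /= !scale1r.
(* Homogeneity is known for positive [t] only, but agreement near 1 determines the derivative. *)
have fx_pow : \forall t \near (1 : R), f (t *: x) = (f x *: (@id R) ^+ k) t.
  near=> t; rewrite fh; last by near: t; exact: lt_nbhsr.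
  by rewrite !fctE mulrC.
rewrite (near_eq_derive _ fx_pow) derive_val expr1n.
by rewrite mulr1 [_%:A]mulr1 mulrC.
Unshelve. all: by end_near. Qed.

(** Differentiating [f (t *: y) = t ^+ k.+1 * f y] in [y] brings out a factor [t] on the left, which
    cancels one power on the right. *)
Lemma partial_homogeneous (k : nat) (i : 'I_n) (t : R) (x : 'rV[R]_n) :
  t != 0 -> (forall y, f (t *: y) = t ^+ k.+1 * f y) ->
  differentiable f x -> differentiable f (t *: x) ->
  partial i f (t *: x) = t ^+ k * partial i f x.
Proof.
move=> t0 fh dfx dftx; apply: (mulfI t0); rewrite mulrA -exprS.
have fE : f \o *:%R t = t ^+ k.+1 *: f by apply/funext => y; exact: fh.
have := congr1 (fun g => 'd g x (delta_mx 0 i)) fE.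
rewrite (diffZ _ dfx) diff_comp// [X in _ \o X]diff_val [LHS]linearZ.
by rewrite /partial (deriveE _ dfx) (deriveE _ dftx).
Qed.

End Euler.

Section Minkowski.
Variables (R : realType) (V : vectType R) (n : nat) (b : n.-tuple V).
Variable F : V -> R[i]%C.
Hypotheses (hb : basis_of fullv b) (hF : is_minkowski b F).

Lemma coordsK : cancel (coords b) (of_coords b).
Proof.
move=> v; rewrite [RHS](coord_basis hb (memvf v)).
by apply: eq_bigr => i _; rewrite mxE -tnth_nth.
Qed.

Lemma coords_eq0 (v : V) : (coords b v == 0) = (v == 0).
Proof.
apply/eqP/eqP => [v0|->]; last by apply/rowP => i; rewrite !mxE linear0.
by rewrite -[v]coordsK v0 /of_coords big1// => i _; rewrite mxE scale0r.
Qed.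

Lemma finsler_metricE (v : V) : (finsler_metric F v)%:C%C = F v ^+ 2.
Proof. by rewrite RRe_real//; exact: (minkowski_real hF). Qed.

Lemma finsler_metric_homogeneous (a : R) (v : V) : 0 < a ->
  finsler_metric F (a *: v) = a ^+ 2 * finsler_metric F v.
Proof.
move=> a0; apply: (@complexI R).
by rewrite rmorphM rmorphXn/= !finsler_metricE (minkowski_homogeneous hF)//
   exprMn.
Qed.

Lemma metric_in_coords_homogeneous (a : R) (x : 'rV[R]_n) : 0 < a ->
  metric_in_coords b F (a *: x) = a ^+ 2 * metric_in_coords b F x.
Proof.
move=> a0; rewrite /metric_in_coords -finsler_metric_homogeneous//.
congr finsler_metric; rewrite /of_coords scaler_sumr.
by apply: eq_bigr => i _; rewrite mxE scalerA.
Qed.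

(* Euler's theorem, first for the partial derivatives, which are homogeneous
   of degree 1, then for the metric itself, of degree 2. *)
Lemma metric_formE (v : V) : v != 0 -> metric_form b F v v v = finsler_metric F v.
Proof.
move=> v0; set f := metric_in_coords b F; set x := coords b v.
have x0 : x != 0 by rewrite coords_eq0.
have [df d2f] := minkowski_smooth hF.
rewrite -[in RHS](coordsK v) -[RHS]/(f x).
(* For fixed [j], the inner sum over [i] becomes Euler's sum for [partial j f]. *)
rewrite /metric_form exchange_big/=.
(* The degree 2 of the metric cancels the factor [2^-1] of the metric tensor. *)
transitivity (2^-1 * \sum_(j < n) x 0 j * partial j f x); last first.
  rewrite (@euler _ _ _ 2) ?mulKf ?pnatr_eq0//; first exact: df.
  by move=> t; exact: metric_in_coords_homogeneous.
rewrite mulr_sumr; apply: eq_bigr => j _.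
have [dfj _] := d2f j.
rewrite -[partial j f x]mul1r -[1 in RHS]/(1%:R) -(@euler _ _ _ 1); first last.
- move=> t t0; apply: partial_homogeneous; first by rewrite gt_eqF.
  + by move=> y; exact: metric_in_coords_homogeneous.
  + exact: df.
  + by apply: df; rewrite /= scaler_eq0 gt_eqF.
- exact: dfj.
rewrite mulr_sumr mulr_sumr; apply: eq_bigr => i _.
by rewrite !mxE; ring.
Qed.

Lemma exists_unit_vector (W : {vspace V}) :
  (forall v : V, v != 0 -> 0 < finsler_metric F v) ->
  W != 0%VS -> exists2 v, v \in W & `|F v| = 1.
Proof.
move=> hpos W0; have v0 : vpick W != 0 by rewrite vpick0.
have fv := hpos _ v0; set a := (Num.sqrt (finsler_metric F (vpick W)))^-1.
have a0 : 0 < a by rewrite invr_gt0 sqrtr_gt0.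
exists (a *: vpick W); first by rewrite memvZ// memv_pick.
(* [F] is complex valued, so the modulus is computed through its square, where only the real [F^2]
   enters. *)
apply/eqP; rewrite -(@pexpr_eq1 _ _ 2)// -normrX -finsler_metricE.
rewrite finsler_metric_homogeneous// exprVn sqr_sqrtr ?ltW//.
by rewrite (mulVf (lt0r_neq0 fv)) rmorph1 normr1.
Qed.

Lemma unit_vector_neq0 (v : V) : `|F v| = 1 -> v != 0.
Proof.
move=> Fv; apply/eqP => v0; move: Fv; rewrite v0 => /eqP.
have -> : F 0 = 0.
  apply/eqP; rewrite -sqrf_eq0 -finsler_metricE.
  (* Homogeneity excludes the factor 0, so scale the zero vector by 2 instead:
     [F^2(0) = 4 F^2(0)]. *)
  have /eqP := @finsler_metric_homogeneous 2 0 (ltr0n _ 2).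
  rewrite scaler0 -subr_eq0 -[X in X - _]mul1r -mulrBl mulf_eq0 => /orP[|/eqP->//].
  by rewrite -natrX subr_eq0 eq_sym pnatr_eq1.
by rewrite normr0 eq_sym oner_eq0.
Qed.

(** The form [g(v)(v, _)], bundled as a linear map so that its kernel is a subspace. *)
Definition metric_hom (v : V) : 'Hom(V, R^o) :=
  \sum_(i < n) \sum_(j < n)
    (metric_tensor b F v i j * coord b i v) *: linfun (coord b j : V -> R^o).

Lemma metric_homE (u v : V) : metric_hom u v = metric_form b F u u v.
Proof.
rewrite sum_lfunE; apply: eq_bigr => i _; rewrite sum_lfunE.
by apply: eq_bigr => j _; rewrite scale_lfunE lfunE.
Qed.

End Minkowski.

Theorem theorem2p3p5 (R : realType) (V : vectType R) (n : nat)
    (b : n.-tuple V) (F : V -> R[i]%C)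
    (hb : basis_of fullv b)
    (hF : is_minkowski b F)
    (hpos : forall v : V, v != 0 -> 0 < finsler_metric F v) :
  exists e : n.-tuple V, finsler_orthonormal_basis b F e.
Proof.
have dimV : \dim {: V} = n by rewrite -(size_basis hb).
have [|e [_ e1 eL]] := exists_pairwise_orthogonal _ V (metric_hom _ _ _ b F)
    (fun v => `|F v| = 1) n fullv
    (fun W => exists_unit_vector _ _ _ _ _ hF W hpos).
  by rewrite dimV.
have gN0 v : v \in e -> metric_form b F v v v != 0.
  by move=> /e1/(unit_vector_neq0 _ _ _ _ _ hF) v0; rewrite metric_formE// gt_eqF// hpos.
exists e; split => [||k]; last exact/e1/mem_tnth.
- rewrite basisEfree subvf size_tuple dimV leqnn !andbT.
  by apply: pairwise_orthogonal_free _ eL => v /gN0; rewrite metric_homE.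
- split=> [k|k l kl]; first exact/gN0/mem_tnth.
  have /(pairwiseP 0)/(_ k l) := eL; rewrite !inE !size_tuple !ltn_ord.
  by rewrite -!tnth_nth metric_homE => /(_ isT isT kl)/eqP.
Qed.
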